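(* Let $X\subseteq\mathbb{R}^n$ be a compact set, contained in an open set $\mathcal{O}$. Suppose that the functions $c,\varphi_1,\dots,\varphi_K,g_1,\dots,g_K:\mathcal{O}\to\mathbb{R}$ are continuous. Consider the problem $$(\mathrm{P})\qquad \operatorname*{minimize}_{x\in X}\ \Phi(x):=c(x)+\sum_{k=1}^K\varphi_k(x)\,\mathbf{1}_{(0,\infty)}(g_k(x)).$$ The following two statements hold. (A) Suppose that for every $k\in\{1,\dots,K\}$ the function $\varphi_k$ is nonnegative on the set $X\cap g_k^{-1}(0)$. Then (P) has an optimal solution; moreover, (P) is equivalent to the problem (MPCC-1): $$\operatorname*{minimize}_{x\in X;\ s}\ c(x)+\sum_{k=1}^K\varphi_k(x)\,s_k\quad\text{subject to}\quad 0\le s_k\perp (g_k(x))_-\ge 0\ \text{ and }\ 0\le 1-s_k\perp (g_k(x))_+\ge 0,\quad \forall k\in\{1,\dots,K\}.$$ (B) Suppose that for every $k\in\{1,\dots,K\}$ the function $\varphi_k$ is nonnegative on the set $X\cap g_k^{-1}((-\infty,0])$. Then (P) is equivalent to either one of the following two problems: (MPCC-2): $$\operatorname*{minimize}_{x\in X;\ s}\ c(x)+\sum_{k=1}^K\varphi_k(x)\,s_k\quad\text{subject to}\quad 0\le 1-s_k\perp (g_k(x))_+\ge 0\ \ \forall k\in\{1,\dots,K\},\ \text{ and } s\in[0,1]^K\ \text{(continuous variables)};$$ (on-off constraints): $$\operatorname*{minimize}_{x\in X;\ z}\ c(x)+\sum_{k=1}^K\varphi_k(x)\,(1-z_k)\quad\text{subject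 to}\quad \big[\,g_k(x)\le 0\ \text{ if } z_k=1\,\big]\ \ \forall k\in\{1,\dots,K\},\ \text{ and } z\in\{0,1\}^K\ \text{(binary variables)}.$$
   Context: $\mathbf{1}_{(0,\infty)}(s)=1$ if $s>0$ and $0$ otherwise. For a scalar $t$, $(t)_+=\max(t,0)$ and $(t)_-=\max(-t,0)$. The variables $s=(s_1,\dots,s_K)$ and $z=(z_1,\dots,z_K)$ are auxiliary $K$-dimensional variables. For scalars, $0\le a\perp b\ge 0$ means $a\ge0$, $b\ge0$, $ab=0$. Two problems are ''equivalent'' if there is a one-to-one correspondence between the optimal solutions of the problems and their optimal objective values are equal.
   Formalization: The one-to-one correspondence is between optimal x of (P) and optimal pairs identified when they share the same x, since a bijection with the pairs themselves fails when φ_k = g_k = 0 at an optimal point; existence of an optimal solution assumes X nonempty. *)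

(* Defs.v *)
From HB Require Import structures.
From mathcomp Require Import all_boot all_order all_algebra.
From mathcomp Require Import all_classical all_reals all_analysis.
Import Order.TTheory GRing.Theory Num.Theory.
Import numFieldNormedType.Exports.

Set Implicit Arguments.
Unset Strict Implicit.
Unset Printing Implicit Defensive.

Local Open Scope classical_set_scope.
Local Open Scope ring_scope.

Record problem (R : realType) (T : Type) := Problem {
  feasible : set T;
  objective : T -> R }.

Definition solutions (R : realType) (T : Type) (P : problem R T) : set T :=
  [set x | feasible P x /\
           forall y, feasible P y -> objective P x <= objective P y].

(* The infimum, in the extended reals: +oo for an infeasible problem. *)
Definition optimal_value (R : realType) (T : Type) (P : problem R T) : \bar R :=
  ereal_inf [set (objective P x)%:E | x in feasible P].

(* In a problem over T * U the T-component is the decision variable and the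
   U-component is auxiliary. *)
Definition solutions_over (R : realType) (T U : Type) (Q : problem R (T * U))
    (x : T) : set (T * U) :=
  [set q | solutions Q q /\ q.1 = x].

(* The optimal solutions of Q up to the value of the auxiliary variable. *)
Definition solution_classes (R : realType) (T U : Type)
    (Q : problem R (T * U)) : set (set (T * U)) :=
  [set solutions_over Q q.1 | q in solutions Q].

(* Equal optimal values, and a one-to-one correspondence between the optimal
   solutions x of P and those of Q.  Optimal solutions of Q that differ only in
   the auxiliary variable are identified: where phi_k(x) = g_k(x) = 0, any
   s_k in [0, 1] is optimal together with an optimal x, so there is in general
   no bijection between the sets of pairs and of points themselves.  The
   correspondence is moreover the one preserving the decision variable. *)
Definition equivalent (R : realType) (T U : Type)
    (P : problem R T) (Q : problem R (T * U)) : Prop :=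
  set_bij (solutions P) (solution_classes Q) (solutions_over Q) /\
  optimal_value P = optimal_value Q.

Definition pos_part (R : realType) (t : R) : R := Num.max t 0.
Definition neg_part (R : realType) (t : R) : R := Num.max (- t) 0.

(* 0 <= a _|_ b >= 0 *)
Definition complementary (R : realType) (a b : R) : Prop :=
  [/\ 0 <= a, 0 <= b & a * b = 0].

(* Below, the functions are total, but only their values on the set X matter. *)

Definition heaviside_problem (R : realType) (n K : nat) (X : set 'rV[R]_n)
    (c : 'rV[R]_n -> R) (phi g : 'I_K -> 'rV[R]_n -> R) :
    problem R 'rV[R]_n :=
  Problem X
    (fun x => c x + \sum_(k < K) phi k x * \1_(`]0, +oo[%classic) (g k x)).

Definition mpcc1 (R : realType) (n K : nat) (X : set 'rV[R]_n)
    (c : 'rV[R]_n -> R) (phi g : 'I_K -> 'rV[R]_n -> R) :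
    problem R ('rV[R]_n * 'rV[R]_K) :=
  Problem
    [set xs : 'rV[R]_n * 'rV[R]_K | X xs.1 /\
       forall k, complementary (xs.2 0 k) (neg_part (g k xs.1)) /\
                 complementary (1 - xs.2 0 k) (pos_part (g k xs.1))]
    (fun xs : 'rV[R]_n * 'rV[R]_K =>
       c xs.1 + \sum_(k < K) phi k xs.1 * xs.2 0 k).

Definition mpcc2 (R : realType) (n K : nat) (X : set 'rV[R]_n)
    (c : 'rV[R]_n -> R) (phi g : 'I_K -> 'rV[R]_n -> R) :
    problem R ('rV[R]_n * 'rV[R]_K) :=
  Problem
    [set xs : 'rV[R]_n * 'rV[R]_K | [/\ X xs.1,
       forall k, complementary (1 - xs.2 0 k) (pos_part (g k xs.1)) &
       forall k, 0 <= xs.2 0 k <= 1]]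
    (fun xs : 'rV[R]_n * 'rV[R]_K =>
       c xs.1 + \sum_(k < K) phi k xs.1 * xs.2 0 k).

Definition on_off (R : realType) (n K : nat) (X : set 'rV[R]_n)
    (c : 'rV[R]_n -> R) (phi g : 'I_K -> 'rV[R]_n -> R) :
    problem R ('rV[R]_n * 'rV[R]_K) :=
  Problem
    [set xz : 'rV[R]_n * 'rV[R]_K | [/\ X xz.1,
       forall k, xz.2 0 k = 1 -> g k xz.1 <= 0 &
       forall k, xz.2 0 k = 0 \/ xz.2 0 k = 1]]
    (fun xz : 'rV[R]_n * 'rV[R]_K =>
       c xz.1 + \sum_(k < K) phi k xz.1 * (1 - xz.2 0 k)).

(* Main.v *)
(* In each relaxation Q, every feasible pair costs at least as much as its
   x-component in (P), and every x extends to a feasible pair of the same cost;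
   this alone makes (P) and Q equivalent.  For the existence of a minimizer, X
   is covered by the compact sets on which each g_k has a prescribed weak sign.
   On the piece with sign pattern S, the continuous function
   c + sum_(k in S) phi_k dominates Phi, and coincides with it at every point
   whose set of indices with g_k > 0 is exactly S.  So the least of the
   finitely many minima of these functions is the minimum of Phi. *)
Require Import Defs.
From HB Require Import structures.
From mathcomp Require Import all_boot all_order all_algebra.
From mathcomp Require Import all_classical all_reals all_analysis.
From mathcomp Require Import lra.
Import Order.TTheory GRing.Theory Num.Theory.
Import numFieldNormedType.Exports.

Set Implicit Arguments.
Unset Strict Implicit.
Unset Printing Implicit Defensive.

Local Open Scope classical_set_scope.
Local Open Scope ring_scope.

(** [lift] carries minimizers of [P] to minimizers of [Q], and the first projection carries them
    back. *)
Lemma equivalent_lift (R : realType) (T U : Type) (P : problem R T)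
    (Q : problem R (T * U)) (lift : T -> U) :
  (forall x, feasible P x -> feasible Q (x, lift x) /\
     objective Q (x, lift x) = objective P x) ->
  (forall q, feasible Q q -> feasible P q.1 /\
     objective P q.1 <= objective Q q) ->
  equivalent P Q.
Proof.
move=> PQ QP.
have sol_lift x : solutions P x -> solutions Q (x, lift x).
  move=> [Px xmin]; have [Qx eqx] := PQ _ Px; split=> // q Qq.
  have [Pq leq] := QP _ Qq.
  by rewrite eqx (le_trans (xmin _ Pq)).
have sol_fst q : solutions Q q -> solutions P q.1.
  move=> [Qq qmin]; have [Pq leq] := QP _ Qq; split=> // y Py.
  have [Qy <-] := PQ _ Py.
  exact: le_trans leq (qmin _ Qy).
split; first split.
- by move=> x /sol_lift Qx; exists (x, lift x).
(* The class of [x] contains [(x, lift x)] and all its members have first component [x], so it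
   determines [x]. *)
- move=> x y /[!inE] /sol_lift Qx _ eqxy.
  have : solutions_over Q x (x, lift x) by [].
  by rewrite eqxy => -[].
- by move=> _ [q /sol_fst Pq <-]; exists q.1.
apply/eqP; rewrite eq_le; apply/andP; split; apply: le_ereal_inf_tmp.
  move=> _ [q /QP[Pq leq] <-].
  apply: (@le_trans _ _ (objective P q.1)%:E); last by rewrite lee_fin.
  by apply: ereal_inf_lbound; exists q.1.
move=> _ [x /PQ[Qx <-] <-].
by apply: ereal_inf_lbound; exists (x, lift x).
Qed.

Lemma indic_pos (R : realType) (t : R) :
  \1_(`]0, +oo[%classic) t = (0 < t)%R%:R :> R.
Proof. by rewrite indicE mem_setE in_itv /= andbT. Qed.

(** [pos_part t] is nonnegative, and nonzero exactly when [t > 0], so the zero product constrains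
    [s] only then. *)
Lemma complementary_pos_part (R : realType) (t s : R) :
  complementary (1 - s) (pos_part t) <-> s <= 1 /\ (0 < t -> s = 1).
Proof.
rewrite /complementary /pos_part subr_ge0 le_max lexx orbT.
split=> [[s1 _ /eqP]|[s1 ts]].
  rewrite mulf_eq0 subr_eq0 => /orP[/eqP<- // | m0]; split=> // t0.
  by move: m0; rewrite max_l ?ltW// gt_eqF.
split=> //; have [t0|t0] := ltP 0 t; last by rewrite mulr0.
by rewrite ts// subrr mul0r.
Qed.

Lemma complementary_neg_part (R : realType) (t s : R) :
  complementary s (neg_part t) <-> 0 <= s /\ (t < 0 -> s = 0).
Proof.
have := complementary_pos_part (- t) (1 - s).
rewrite opprB addrC subrK /pos_part => ->.
rewrite lerBlDr lerDl oppr_gt0; split=> -[s0 ts]; split=> // /ts; lra.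
Qed.

(** The objective may jump where some [g k] vanishes; since the indicator is 0 and [phi k]
    nonnegative there, the value taken is the lower one. *)
Lemma heaviside_solutions_nonempty (R : realType) (n K : nat)
    (X : set 'rV[R]_n) (c : 'rV[R]_n -> R) (phi g : 'I_K -> 'rV[R]_n -> R) :
  compact X -> X !=set0 -> {within X, continuous c} ->
  (forall k, {within X, continuous (phi k)}) ->
  (forall k, {within X, continuous (g k)}) ->
  (forall k x, X x -> g k x = 0 -> 0 <= phi k x) ->
  solutions (heaviside_problem X c phi g) !=set0.
Proof.
move=> cptX [x0 Xx0] cc cphi cg phi0.
(* Both sign sets contain 0, which keeps the pieces closed but lets them overlap. *)
pose sgn (S : {set 'I_K}) k : set R :=
  if k \in S then `[0, +oo[%classic else `]-oo, 0]%classic.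
pose piece S := X `&` \bigcap_(k in setT) (g k @^-1` sgn S k).
pose bound (S : {set 'I_K}) x := c x + \sum_(k in S) phi k x.
pose pattern x := [set k | 0 < g k x]%SET.
(* The [g k] are continuous only within [X], so the argument runs in the subspace topology of
   [X]. *)
have cpt_piece S : compact (piece S).
  rewrite /piece setIC; apply/compact_subspaceIP; rewrite setIC.
  apply: compact_closedI.
    rewrite -[X in compact X]setIid.
    by apply/(compact_subspaceIP X X); rewrite setIid.
  apply: closed_bigI => k _; apply: (continuous_closedP _).1; first exact: cg.
  by rewrite /sgn; case: ifP => _; exact: itv_closed_ends_closed.
have bound_cont S : {within piece S, continuous (bound S)}.
  apply: (@continuous_subspaceW _ _ _ X); first exact: subIsetl.
  apply: within_continuousD => // x.
  by apply: cvg_big => [|k _]; [exact: add_continuous | exact: cphi].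
have piece_pattern x : X x -> piece (pattern x) x.
  move=> Xx; split=> // k _; rewrite /= /sgn inE.
  by case: ltP => gx; rewrite /= in_itv /= ?andbT // ltW.
have bound_pattern x :
    bound (pattern x) x = objective (heaviside_problem X c phi g) x.
  rewrite /bound /= big_mkcond /=; congr (_ + _); apply: eq_bigr => k _.
  by rewrite indic_pos inE; case: ifP; rewrite ?mulr1 ?mulr0.
have bound_ge S x : piece S x ->
    objective (heaviside_problem X c phi g) x <= bound S x.
  move=> [Xx Sx]; rewrite /bound /= lerD2l.
  rewrite [leRHS]big_mkcond; apply: ler_sum => k _.
  have := Sx k I; rewrite /= /sgn indic_pos.
  case: ifP => _; rewrite /= in_itv /= ?andbT => gx.
    (* The two sums can differ only at indices of [S] with [g k x = 0]. *)
    case: ltgtP gx => // [_|/esym gx0] _; rewrite ?mulr1 ?mulr0 //.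
    exact: phi0.
  by rewrite ltNge gx mulr0.
have /choice[m mP] S : exists y, piece S !=set0 ->
    piece S y /\ forall x, piece S x -> bound S y <= bound S x.
  (* For an empty piece, [x0] is a dummy value. *)
  have [S0|S0] := pselect (piece S !=set0); last by exists x0.
  have [y /[!inE] Sy ymin] := compact_EVT_min S0 (cpt_piece S) (bound_cont S).
  by exists y => _; split=> // x Sx; apply: ymin; rewrite inE.
pose nonempty S := `[< piece S !=set0 >].
have S0 : nonempty (pattern x0).
  by apply/asboolP; exists x0; exact: piece_pattern.
case: (@arg_minP _ _ _ _ nonempty (fun S => bound S (m S)) S0)
  => S /asboolP/mP[Sm _] Smin.
exists (m S); split=> [|y Xy]; first by case: Sm.
have Sy := piece_pattern _ Xy.
have [_ ymin] := mP _ (ex_intro _ y Sy).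
(* With [S'] the pattern of [y], the chain is [bound S (m S) <= bound S' (m S') <= bound S' y]. *)
apply: le_trans (bound_ge _ _ Sm) _; rewrite -bound_pattern.
by apply: le_trans (Smin _ _) (ymin _ Sy); apply/asboolP; exists y.
Qed.

Theorem proposition1 (R : realType) (n K : nat) (X O : set 'rV[R]_n)
    (c : 'rV[R]_n -> R) (phi g : 'I_K -> 'rV[R]_n -> R)
    (X_compact : compact X) (O_open : open O) (XO : X `<=` O)
    (c_cont : {within O, continuous c})
    (phi_cont : forall k, {within O, continuous (phi k)})
    (g_cont : forall k, {within O, continuous (g k)}) :
  ((forall k x, (X `&` g k @^-1` [set 0]) x -> 0 <= phi k x) ->
     (X !=set0 -> solutions (heaviside_problem X c phi g) !=set0) /\
     equivalent (heaviside_problem X c phi g) (mpcc1 X c phi g)) /\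
  ((forall k x, (X `&` g k @^-1` `]-oo, 0]) x -> 0 <= phi k x) ->
     equivalent (heaviside_problem X c phi g) (mpcc2 X c phi g) /\
     equivalent (heaviside_problem X c phi g) (on_off X c phi g)).
Proof.
have sol0 : (forall k x, X x -> g k x = 0 -> 0 <= phi k x) -> X !=set0 ->
    solutions (heaviside_problem X c phi g) !=set0.
  move=> phi0 X0; apply: heaviside_solutions_nonempty => // [|k|k];
    exact: continuous_subspaceW XO _.
pose s x : 'rV[R]_K := \row_k \1_(`]0, +oo[%classic) (g k x).
have sE x k : s x 0 k = (0 < g k x)%R%:R by rewrite mxE indic_pos.
split=> phi0; split.
- by apply: sol0 => k x Xx gx; apply: phi0.
- apply: (@equivalent_lift _ _ _ _ _ s) => [x Xx|[x t] /= [Xx tP]].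
    split=> /=; last by under eq_bigr do rewrite mxE.
    split=> //= k; rewrite complementary_neg_part complementary_pos_part sE.
    by case: ltgtP.
  split=> //; rewrite lerD2l; apply: ler_sum => k _; rewrite indic_pos.
  have [/complementary_neg_part[t0 tneg]] := tP k.
  move=> /complementary_pos_part[_ tpos].
  (* A nonzero [g k x] forces [t 0 k] to equal the indicator; only [g k x = 0] leaves it free. *)
  case: ltgtP tneg tpos => [_ -> //|_ _ -> //|gx _ _].
  by rewrite mulr0 mulr_ge0//; apply: phi0.
- apply: (@equivalent_lift _ _ _ _ _ s) => [x Xx|[x t] /= [Xx tP t01]].
    split=> /=; last by under eq_bigr do rewrite mxE.
    split=> //= k; last by rewrite sE; case: ltP; rewrite ?lexx ?ler01.
    by rewrite complementary_pos_part sE; case: ltP; rewrite ?ler01.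
  split=> //; rewrite lerD2l; apply: ler_sum => k _; rewrite indic_pos.
  have /complementary_pos_part[_ tpos] := tP k.
  (* Here [t 0 k] is free wherever [g k x <= 0], hence the stronger sign hypothesis. *)
  case: ltP tpos => [_ -> //|gx _].
  by case/andP: (t01 k) => tk0 _; rewrite mulr0 mulr_ge0//; apply: phi0.
- apply: (@equivalent_lift _ _ _ _ _ (fun x => const_mx 1 - s x)).
    move=> x Xx; split=> /=.
      split=> //= k; rewrite !mxE indic_pos; case: ltP => // _.
      + by rewrite subrr => /esym/eqP; rewrite oner_eq0.
      + by left; rewrite subrr.
      + by right; rewrite subr0.
    by congr (_ + _); apply: eq_bigr => k _; rewrite !mxE subKr.
  move=> [x z] /= [Xx zP z01].
  split=> //; rewrite lerD2l; apply: ler_sum => k _; rewrite indic_pos.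
  (* Setting [z 0 k = 0] is allowed even when [g k x <= 0], but then costs [phi k x >= 0]. *)
  have [zk|zk] := z01 k; rewrite zk ?subr0 ?subrr; last first.
    by rewrite ltNge zP.
  by case: ltP => // gx; rewrite mulr0 mulr1; apply: phi0.
Qed.
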